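(* Let $(V;\mathfrak f,\mathfrak g)$ be a dual-modular instance normalized so that $\mathfrak f(V)=\mathfrak g(V)=1$, with density vector $\rho^*$. Run the Frank-Wolfe procedure described in the context (for the objective $\mathsf D_\vartheta$ with $\vartheta(t)=t^2$) for $T$ steps, producing $(x^{(T)},y^{(T)})\in\mathcal B^{\ge}_{\mathfrak f}\times\mathcal B^{\le}_{\mathfrak g}$, and let $\rho^{(T)}_u=x^{(T)}_u/y^{(T)}_u$. Then $\|\rho^{(T)}-\rho^*\|_2\le\frac{O(1)}{\mathfrak g_{\min}^{2.5}\sqrt{T+2}}$, and for all $u\in V$, $\left|\frac{\rho^{(T)}_u-\rho^*_u}{\rho^*_u}\right|\le\frac{O(1)}{\mathfrak f_{\min}\,\mathfrak g_{\min}^{2.5}\sqrt{T+2}}$, where $O(1)$ denotes an absolute constant.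
   Context: $V$ is a finite ground set. A dual-modular instance $(V;\mathfrak f,\mathfrak g)$ consists of $\mathfrak f,\mathfrak g:2^V\to\mathbb R_{\ge0}$ with $\mathfrak f(\emptyset)=\mathfrak g(\emptyset)=0$, $\mathfrak f$ monotone and supermodular, $\mathfrak g$ submodular and strictly monotone ($A\subsetneq B\Rightarrow\mathfrak g(A)<\mathfrak g(B)$). $h(S\mid A):=h(S\cup A)-h(A)$; $x(S)=\sum_{u\in S}x_u$. $\mathcal B^{\ge}_{\mathfrak f}=\{x\ge0:x(V)=\mathfrak f(V),\ x(S)\ge\mathfrak f(S)\ \forall S\}$, $\mathcal B^{\le}_{\mathfrak g}=\{y\ge0:y(V)=\mathfrak g(V),\ y(S)\le\mathfrak g(S)\ \forall S\}$. Density vector $\rho^*$: $S_0=\emptyset$; for $i\ge1$, with $S_{<i}=\bigcup_{j<i}S_j$ and $V_i=V\setminus S_{<i}\ne\emptyset$, let $S_i$ be the (unique) inclusion-maximal nonempty $S\subseteq V_i$ maximizing $\mathfrak f(S\mid S_{<i})/\mathfrak g(S\mid S_{<i})$ and set $\rho^*_u$ to this maximum for $u\in S_i$; stop when $S_i=V_i$. For a permutation $\sigma$ of $V$ and $h:2^V\to\mathbb R$, $h^\sigma\in\mathbb R^V$ is $h^\sigma(u)=h(\{u\}\mid\{w:w\text{ precedes }u\text{ in }\sigma\})$. $\mathfrak f_{\min}=\min_{\sigma,u}\mathfrak f^\sigma(u)$, $\mathfrak g_{\min}=\min_{\sigma,u}\mathfrak g^\sigma(u)$. Frank-Wolfe procedure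 (applied to minimizing $\mathsf D_\vartheta(x\|y)=\sum_u y_u\vartheta(x_u/y_u)$ over $\mathcal B^{\ge}_{\mathfrak f}\times\mathcal B^{\le}_{\mathfrak g}$): pick an arbitrary permutation $\sigma_0$ and set $(x^{(0)},y^{(0)})=(\mathfrak f^{\sigma_0},\mathfrak g^{\sigma_0})$. For $k=0,\dots,T-1$: let $\sigma_{k+1}$ be a permutation sorting $V$ in non-increasing order of $x^{(k)}_v/y^{(k)}_v$ (ties arbitrary), and set $(x^{(k+1)},y^{(k+1)})=(1-\gamma_k)(x^{(k)},y^{(k)})+\gamma_k(\mathfrak f^{\sigma_{k+1}},\mathfrak g^{\sigma_{k+1}})$ with $\gamma_k=\frac2{k+2}$. *)

(* Defs.v *)
From mathcomp Require Import all_boot all_order all_algebra.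
From mathcomp Require Import classical_sets reals exp.
From mathcomp Require Import finset.
Set Implicit Arguments.
Unset Strict Implicit.
Unset Printing Implicit Defensive.
Import Order.TTheory GRing.Theory Num.Theory.
Local Open Scope ring_scope.

Section DualModular.
Variables (R : realType) (V : finType).
Implicit Types (f g h : {set V} -> R) (x y rho : V -> R) (A B P S : {set V}).

Definition marginal h S A : R := h (S :|: A) - h A.

Definition supermodular f : Prop :=
  forall A B, f A + f B <= f (A :|: B) + f (A :&: B).

Definition submodular g : Prop :=
  forall A B, g (A :|: B) + g (A :&: B) <= g A + g B.

Record dual_modular f g : Prop := DualModular {
  dm_f_ge0 : forall A, 0 <= f A;
  dm_g_ge0 : forall A, 0 <= g A;
  dm_f0 : f set0 = 0;
  dm_g0 : g set0 = 0;
  dm_f_mono : forall A B, A \subset B -> f A <= f B;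
  dm_f_super : supermodular f;
  dm_g_sub : submodular g;
  dm_g_smono : forall A B, A \proper B -> g A < g B }.

Definition vsum x S : R := \sum_(u in S) x u.

Definition base_ge f x : Prop :=
  [/\ forall u, 0 <= x u, vsum x [set: V] = f [set: V]
    & forall S, f S <= vsum x S].

Definition base_le g y : Prop :=
  [/\ forall u, 0 <= y u, vsum y [set: V] = g [set: V]
    & forall S, vsum y S <= g S].

Definition density f g P S : R := marginal f S P / marginal g S P.

Definition densest f g P S : bool :=
  [&& S != set0, S \subset ~: P &
      [forall S' : {set V}, (S' != set0) && (S' \subset ~: P) ==>
        (density f g P S' <= density f g P S)]].

(* [peeling f g rho P] : when P is the union of the blocks S_j already removed,
   rho is on V \ P the vector obtained by continuing the density decomposition
   until V is exhausted. *)
Inductive peeling f g rho : {set V} -> Prop :=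
| peeling_stop : peeling f g rho [set: V]
| peeling_step P S :
    maxset (densest f g P) S ->
    {in S, forall u, rho u = density f g P S} ->
    peeling f g rho (P :|: S) ->
    peeling f g rho P.

Definition density_vector f g rho : Prop := peeling f g rho set0.

(* A permutation of V is the sequence listing V in that order. *)
Definition is_ordering (s : seq V) : bool := perm_eq s (enum V).

Definition greedy h (s : seq V) (u : V) : R :=
  marginal h [set u] [set w | (index w s < index u s)%N].

(* The set is finite, and nonempty when V is, so that inf is a minimum. *)
Definition marginal_min h : R :=
  inf [set r | exists s u, is_ordering s /\ r = greedy h s u]%classic.

Definition fw_gamma (k : nat) : R := 2 / k.+2%:R.

(* The choice of permutations s drives both coordinates of the Frank-Wolfe
   iterates: x^(k) = fw_iter f s k and y^(k) = fw_iter g s k. *)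
Fixpoint fw_iter h (s : nat -> seq V) (k : nat) : V -> R :=
  if k is k'.+1 then
    fun u => (1 - fw_gamma k') * fw_iter h s k' u
             + fw_gamma k' * greedy h (s k'.+1) u
  else greedy h (s 0%N).

Definition fw_ratio f g (s : nat -> seq V) (k : nat) (u : V) : R :=
  fw_iter f s k u / fw_iter g s k u.

Definition fw_run f g (T : nat) (s : nat -> seq V) : Prop :=
  (forall k, (k <= T)%N -> is_ordering (s k)) /\
  (forall k, (k < T)%N ->
     sorted (fun v w => fw_ratio f g s k w <= fw_ratio f g s k v) (s k.+1)).

Definition norm2 x : R := Num.sqrt (\sum_u x u ^+ 2).

End DualModular.

(* Main.v *)
(** For a block S_i of the density decomposition with density rho_i let
    g_i = g(S_i | S_<i), and put Phi(t) = sum_i g_i max(0, rho_i - t)^2.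
    Write D(x, y) = sum_u x_u^2 / y_u and L_r(x, y) = sum_u (2 r_u x_u - r_u^2 y_u).
    - For t >= 0 and every A, uncrossing A with the blocks gives
      f(A) - t g(A) <= sum_i g_i max(0, rho_i - t).  By Abel summation, the
      greedy pair (s, t) of an ordering sorted by r then satisfies
      L_r(s, t) <= Phi(0).
    - The densities rho_i decrease, so that Abel summation over the blocks also
      gives L_rho(x, y) >= Phi(0) on the product of the two base polytopes.
    - For r = x / y, completing the square gives
      D(x', y') = L_r(x', y') + sum_u (x'_u - r_u y'_u)^2 / y'_u.  As D(x, y) =
      L_r(x, y), a Frank-Wolfe step with parameter c multiplies D - Phi(0) by
      1 - c up to an error 2 c^2 / g_min^3, hence
      D - Phi(0) <= 8 / (g_min^3 (T + 2)).
    - The same identity at r = rho bounds g_min * |x / y - rho|^2 by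
      D(x, y) - L_rho(x, y) <= D(x, y) - Phi(0).
    Thus Phi(0) acts as the optimal value of D, and no minimizer of D is
    needed. *)
Require Import Defs.
From mathcomp Require Import all_boot all_order all_algebra.
From mathcomp Require Import ring lra.
From mathcomp Require Import exp reals.
Import Order.TTheory GRing.Theory Num.Theory.
Local Open Scope ring_scope.

(** * Greedy vectors, base polytopes and least marginals *)

Section Greedy.
Local Set Implicit Arguments.
Local Unset Strict Implicit.
Variables (R : realType) (V : finType).
Implicit Types (h f g : {set V} -> R) (x y : V -> R) (s : seq V)
  (A S : {set V}) (u : V).

Lemma ordering_uniq s : is_ordering s -> uniq s.
Proof. by move=> hs; rewrite (perm_uniq hs) enum_uniq. Qed.

Lemma mem_ordering s u : is_ordering s -> u \in s.
Proof. by move=> hs; rewrite (perm_mem hs) mem_enum. Qed.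

Lemma big_ordering s (P : pred V) (F : V -> R) : is_ordering s ->
  \sum_(u | P u) F u = \sum_(u <- s | P u) F u.
Proof. by move=> hs; rewrite (perm_big _ hs) big_enum_cond. Qed.

Lemma greedy_cat h (s1 s2 : seq V) u : uniq (s1 ++ u :: s2) ->
  greedy h (s1 ++ u :: s2) u = h (u |: [set:: s1]) - h [set:: s1].
Proof.
rewrite cat_uniq /= negb_or => /and3P[_ /andP[us1 _] _].
rewrite /greedy /marginal.
suff -> : [set w | (index w (s1 ++ u :: s2) < index u (s1 ++ u :: s2))%N]
  = [set:: s1] by [].
apply/setP => w; rewrite !inE !index_cat (negbTE us1) /= eqxx addn0.
by case: ifP => ws1; rewrite ?index_mem // ltnNge leq_addr.
Qed.

Lemma set_cons_rcons (s1 : seq V) u : [set:: rcons s1 u] = u |: [set:: s1].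
Proof. by apply/setP => w; rewrite !inE mem_rcons inE. Qed.

Lemma set_ordering s : is_ordering s -> [set:: s] = setT.
Proof. by move=> hs; apply/setP => w; rewrite !inE mem_ordering. Qed.

Lemma vsum_greedyT h s : is_ordering s ->
  vsum (greedy h s) setT = h setT - h set0.
Proof.
move=> hs; rewrite /vsum big_mkcond (big_ordering _ _ hs) /=.
have key s2 s1 : s = s1 ++ s2 ->
    \sum_(u <- s2) greedy h s u = h [set:: s] - h [set:: s1].
  elim: s2 s1 => [|u s2 IH] s1 es; first by rewrite big_nil es cats0 subrr.
  rewrite big_cons (IH (rcons s1 u)) ?cat_rcons// set_cons_rcons.
  by rewrite {1}es greedy_cat -?es ?ordering_uniq// addrC addrA subrK.
under eq_bigr do rewrite inE.
rewrite (key s [::]) // set_ordering//; congr (_ - h _).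
Qed.

(** For u in S, supermodularity makes the marginal of u over its whole prefix at least its marginal
    over the part of the prefix inside S. The latter marginals telescope. *)
Lemma vsum_greedy_ge h s S : supermodular h -> is_ordering s ->
  h S - h set0 <= vsum (greedy h s) S.
Proof.
move=> sm hs; rewrite /vsum (big_ordering _ _ hs).
have key s2 s1 : s = s1 ++ s2 ->
    h (S :&: [set:: s]) - h (S :&: [set:: s1])
      <= \sum_(u <- s2 | u \in S) greedy h s u.
  elim: s2 s1 => [|u s2 IH] s1 es; first by rewrite big_nil es cats0 subrr.
  have us := ordering_uniq hs.
  have u1 : u \notin s1.
    by move: us; rewrite es cat_uniq /= negb_or => /and3P[_ /andP[]].
  have := IH (rcons s1 u); rewrite cat_rcons set_cons_rcons => /(_ es).
  have gu : greedy h s u = h (u |: [set:: s1]) - h [set:: s1].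
    by rewrite es greedy_cat -?es.
  rewrite big_cons gu; case: ifP => uS.
    have := sm (u |: (S :&: [set:: s1])) [set:: s1].
    have -> : u |: S :&: [set:: s1] :|: [set:: s1] = u |: [set:: s1].
      by apply/setP => w; rewrite !inE; case: (w == u); case: (w \in S);
        case: (w \in s1).
    have -> : (u |: S :&: [set:: s1]) :&: [set:: s1] = S :&: [set:: s1].
      apply/setP => w; rewrite !inE; case: eqP => [->|_] /=.
        by rewrite (negbTE u1) andbF.
      by case: (w \in S); case: (w \in s1).
    have -> : S :&: (u |: [set:: s1]) = u |: S :&: [set:: s1].
      by apply/setP => w; rewrite !inE; case: eqP => [->|//]; rewrite uS.
    lra.
  suff -> : S :&: (u |: [set:: s1]) = S :&: [set:: s1] by [].
  by apply/setP => w; rewrite !inE; case: eqP => [->|//]; rewrite uS.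
have := key s [::] erefl; rewrite set_ordering// setIT.
by congr (_ - h _ <= _); apply/setP => w; rewrite !inE andbF.
Qed.

Lemma vsum_greedy_le h s S : submodular h -> is_ordering s ->
  vsum (greedy h s) S <= h S - h set0.
Proof.
move=> sm hs.
have smN : supermodular (fun A => - h A).
  by move=> A B; rewrite -!opprD lerN2.
have := vsum_greedy_ge S smN hs.
have -> : vsum (greedy (fun A => - h A) s) S = - vsum (greedy h s) S.
  by rewrite /vsum -sumrN; apply: eq_bigr => u _; rewrite /greedy /marginal opprD.
lra.
Qed.

Lemma greedy_ge0 h s u : (forall A B : {set V}, A \subset B -> h A <= h B) ->
  0 <= greedy h s u.
Proof. by move=> hm; rewrite /greedy /marginal subr_ge0 hm// subsetUr. Qed.

Lemma greedy_base_ge f g s : dual_modular f g -> is_ordering s ->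
  base_ge f (greedy f s).
Proof.
move=> fg hs; have f0 := dm_f0 fg; split.
- by move=> u; apply/greedy_ge0/(dm_f_mono fg).
- by rewrite vsum_greedyT// f0 subr0.
- by move=> S; have := vsum_greedy_ge S (dm_f_super fg) hs; rewrite f0 subr0.
Qed.

Lemma dm_g_mono f g : dual_modular f g -> forall A B : {set V}, A \subset B -> g A <= g B.
Proof.
move=> fg A B; rewrite subEproper => /orP[/eqP->//|AB].
exact/ltW/(dm_g_smono fg).
Qed.

Lemma greedy_base_le f g s : dual_modular f g -> is_ordering s ->
  base_le g (greedy g s).
Proof.
move=> fg hs; have g0 := dm_g0 fg; split.
- by move=> u; apply/greedy_ge0/(dm_g_mono fg).
- by rewrite vsum_greedyT// g0 subr0.
- by move=> S; have := vsum_greedy_le S (dm_g_sub fg) hs; rewrite g0 subr0.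
Qed.

Lemma vsum_conv x y (a : R) S :
  vsum (fun u => (1 - a) * x u + a * y u) S = (1 - a) * vsum x S + a * vsum y S.
Proof. by rewrite /vsum big_split /= -!mulr_sumr. Qed.

Lemma base_ge_conv f x y (a : R) : 0 <= a <= 1 -> base_ge f x -> base_ge f y ->
  base_ge f (fun u => (1 - a) * x u + a * y u).
Proof.
move=> /andP[a0 a1] [x0 xT xS] [y0 yT yS]; have a1' : 0 <= 1 - a by rewrite subr_ge0.
split=> [u||S].
- by rewrite addr_ge0 ?mulr_ge0.
- by rewrite vsum_conv xT yT; ring.
- rewrite vsum_conv -[leLHS](_ : (1 - a) * f S + a * f S = _); last by ring.
  by rewrite lerD ?ler_wpM2l.
Qed.

Lemma base_le_conv g x y (a : R) : 0 <= a <= 1 -> base_le g x -> base_le g y ->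
  base_le g (fun u => (1 - a) * x u + a * y u).
Proof.
move=> /andP[a0 a1] [x0 xT xS] [y0 yT yS]; have a1' : 0 <= 1 - a by rewrite subr_ge0.
split=> [u||S].
- by rewrite addr_ge0 ?mulr_ge0.
- by rewrite vsum_conv xT yT; ring.
- rewrite vsum_conv -[leRHS](_ : (1 - a) * g S + a * g S = _); last by ring.
  by rewrite lerD ?ler_wpM2l.
Qed.

(** List A, then u, then the rest. Thus [marginal_min] is a lower bound for the marginals over
    arbitrary sets. *)
Lemma exists_ordering_prefix A u : u \notin A ->
  exists2 s, is_ordering s & forall h, greedy h s u = h (u |: A) - h A.
Proof.
move=> uA; pose s := enum A ++ u :: enum (~: (u |: A)).
have us : uniq s.
  rewrite cat_uniq /= !enum_uniq !mem_enum negb_or uA /= !inE eqxx /= andbT.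
  apply/hasPn => w; rewrite mem_enum !inE negb_or => /andP[_].
  by rewrite mem_enum.
exists s => [|h]; last by rewrite greedy_cat// set_enum.
apply: uniq_perm; rewrite ?enum_uniq// => w.
rewrite mem_enum mem_cat inE !mem_enum !inE.
by case: (w \in A); case: (w == u).
Qed.

Lemma marginal_min_le_greedy h s u : (forall A B : {set V}, A \subset B -> h A <= h B) ->
  is_ordering s -> marginal_min h <= greedy h s u.
Proof.
move=> hm hs; apply: ge_inf; last by exists s, u.
by exists 0 => _ [s' [v [_ ->]]]; exact: greedy_ge0.
Qed.

Lemma marginal_min_le h A u : (forall A B : {set V}, A \subset B -> h A <= h B) ->
  u \notin A -> marginal_min h <= h (u |: A) - h A.
Proof.
by move=> hm /exists_ordering_prefix[s hs <-]; exact: marginal_min_le_greedy.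
Qed.

(** The infimum dominates a minimum over the finitely many pairs (A, u) with u outside A. The point
    [u0] excludes the infimum of the empty set, which is 0 by convention. *)
Lemma marginal_min_gt0 h (u0 : V) : (forall A B : {set V}, A \proper B -> h A < h B) ->
  0 < marginal_min h.
Proof.
move=> hm.
pose d := \big[Order.min/1]_(p : {set V} * V | p.2 \notin p.1)
  (h (p.2 |: p.1) - h p.1).
have d0 : 0 < d.
  by apply: lt_bigmin => // -[A u] /= uA; rewrite subr_gt0 hm// properUr ?sub1set.
apply: (lt_le_trans d0); apply: lb_le_inf.
  by exists (greedy h (enum V) u0), (enum V), u0; split => //; exact: perm_refl.
move=> _ [s [u [hs ->]]]; rewrite /d /greedy /marginal.
set A := [set w | _].
have uA : u \notin A by rewrite inE ltnn.
exact: (@bigmin_le_cond _ _ _ 1 (A, u) (fun p : {set V} * V => p.2 \notin p.1)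
  (fun p : {set V} * V => h (p.2 |: p.1) - h p.1)).
Qed.

End Greedy.

(** * Density decomposition and its potential *)

Section DensityVector.
Local Set Implicit Arguments.
Local Unset Strict Implicit.
Variables (R : realType) (V : finType).
Implicit Types (f g : {set V} -> R) (x y rho : V -> R) (A P S : {set V}).

(** Strict monotonicity makes the denominators positive, so they can be cleared. The cleared
    inequality also covers the empty set, as is needed for intersections [A :&: S]. *)
Lemma densest_spec f g P S : dual_modular f g -> densest f g P S ->
  [/\ S \subset ~: P, 0 < marginal g S P,
      marginal f S P = density f g P S * marginal g S P
    & forall S', S' \subset ~: P ->
        marginal f S' P <= density f g P S * marginal g S' P].
Proof.
move=> fg /and3P[S0 SP /forallP mx].
have gpos S' : S' != set0 -> S' \subset ~: P -> 0 < marginal g S' P.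
  move=> /set0Pn[u uS] S'P; rewrite subr_gt0 (dm_g_smono fg)// properUr//.
  apply/subsetPn; exists u => //.
  by have := subsetP S'P u uS; rewrite inE.
have gS := gpos _ S0 SP.
split=> // [|S' S'P]; first by rewrite /density divfK ?gt_eqF.
have [->|S'0] := eqVneq S' set0.
  by rewrite /marginal set0U !subrr mulr0.
by rewrite -ler_pdivrMr ?gpos//; have := mx S'; rewrite S'0 S'P.
Qed.

(** Uncrosses A ∪ P with P ∪ S: their intersection is (A ∩ S) ∪ P. *)
Lemma supermodular_marginal f A P S : supermodular f ->
  marginal f A P <= marginal f A (P :|: S) + marginal f (A :&: S) P.
Proof.
move=> /(_ (A :|: P) (P :|: S)); rewrite /marginal.
have -> : A :|: P :|: (P :|: S) = A :|: (P :|: S).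
  by apply/setP => w; rewrite !inE; case: (w \in A); case: (w \in P).
have -> : (A :|: P) :&: (P :|: S) = A :&: S :|: P.
  by apply/setP => w; rewrite !inE; case: (w \in A); case: (w \in P);
    case: (w \in S).
lra.
Qed.

Lemma submodular_marginal g A P S : submodular g ->
  marginal g A (P :|: S) + marginal g (A :&: S) P <= marginal g A P.
Proof.
move=> sg; have sm : supermodular (fun B => - g B).
  by move=> B C; rewrite -!opprD lerN2.
by have := supermodular_marginal A P S sm; rewrite /marginal; lra.
Qed.

Definition sqpos (t : R) : R := Num.max 0 t ^+ 2.

Lemma sqpos_ge0 t : 0 <= sqpos t. Proof. exact: sqr_ge0. Qed.

(* Hermite-Hadamard: the right-hand side is the integral over [a, b] of the
   convex function t |-> 2 max(0, l - t), whose value at the midpoint of [a, b]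
   is at least 2 l - a - b. *)
Lemma sqpos_midpoint (l a b : R) : a <= b ->
  (b - a) * (2 * l - a - b) <= sqpos (l - a) - sqpos (l - b).
Proof.
move=> ab; rewrite /sqpos !maxEle.
case: ifP => ha; case: ifP => hb; nra.
Qed.

Lemma sqpos_homo (l a b : R) : a <= b -> sqpos (l - b) <= sqpos (l - a).
Proof.
move=> ab; rewrite /sqpos !maxEle; case: ifP => ha; case: ifP => hb; nra.
Qed.

(* [Phi t] is the sum of [marginal g S P * sqpos (density - t)] over the blocks
   still to be removed. The terms in [mu], which vanish for P = set0, are the
   boundary terms of Abel summation over these blocks; they make the induction
   go through. *)
Lemma peeling_potential f g rho P : dual_modular f g -> peeling f g rho P ->
  exists Phi : R -> R, [/\ forall t, 0 <= Phi t,
    forall A a b, 0 <= a -> a <= b ->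
      2 * (b - a) * marginal f A P - (b ^+ 2 - a ^+ 2) * marginal g A P
        <= Phi a - Phi b
  & forall x y mu, base_ge f x -> base_le g y -> 0 <= mu ->
      (forall S, S \subset ~: P -> marginal f S P <= mu * marginal g S P) ->
      Phi 0 <= \sum_(u in ~: P) (2 * rho u * x u - rho u ^+ 2 * y u)
        + 2 * mu * (vsum x P - f P) + mu ^+ 2 * (g P - vsum y P)].
Proof.
move=> fg; elim=> [|{}P S].
  exists (fun=> 0); split=> // [A a b _ _|x y mu [_ -> _] [_ -> _] _ _].
    by rewrite /marginal setUT !subrr !mulr0 subrr.
  by rewrite setCT big_set0 !subrr !mulr0 !addr0.
move=> /maxsetp dS rhoS _ [Phi [Phi0 PhiUp PhiLow]].
have [SP gS fS dom] := densest_spec fg dS.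
set l := density f g P S in rhoS fS dom.
have l0 : 0 <= l.
  by rewrite divr_ge0 ?(ltW gS)// subr_ge0 (dm_f_mono fg)// subsetUr.
exists (fun t => Phi t + marginal g S P * sqpos (l - t)); split.
- by move=> t; rewrite addr_ge0// mulr_ge0 ?sqpos_ge0// ltW.
- move=> A a b a0 ab.
  (* The part of A beyond P ∪ S is left to the induction hypothesis. The part inside S has
     f-marginal at most l times its g-marginal, and [mid] charges it to the new block. By [homo],
     this charge only grows when the g-marginal is raised to that of all of S. *)
  have hF := supermodular_marginal A P S (dm_f_super fg).
  have hG := submodular_marginal A P S (dm_g_sub fg).
  have hU := PhiUp A a b a0 ab.
  have ASP : A :&: S \subset ~: P by rewrite (subset_trans (subsetIr _ _)).
  have hl := dom _ ASP.
  have G20 : 0 <= marginal g (A :&: S) P.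
    by rewrite subr_ge0 (dm_g_mono fg)// subsetUr.
  have G2S : marginal g (A :&: S) P <= marginal g S P.
    by rewrite lerD2r (dm_g_mono fg)// setSU// subsetIr.
  have mid := sqpos_midpoint l ab.
  have homo := sqpos_homo l ab.
  move: hF hG hU hl G20 G2S.
  move: (marginal f A (P :|: S)) (marginal g A (P :|: S))
    (marginal f (A :&: S) P) (marginal g (A :&: S) P)
    (marginal f A P) (marginal g A P) => F1 G1 F2 G2 F G hF hG hU hl G20 G2S.
  have s1 : 2 * (b - a) * F <= 2 * (b - a) * (F1 + l * G2).
    apply: ler_wpM2l; first by rewrite mulr_ge0 ?subr_ge0.
    by rewrite (le_trans hF)// lerD2l.
  have s2 : (b ^+ 2 - a ^+ 2) * (G1 + G2) <= (b ^+ 2 - a ^+ 2) * G.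
    by apply: ler_wpM2l => //; rewrite subr_ge0 lerXn2r// nnegrE (le_trans a0).
  have s3 := ler_wpM2l G20 mid.
  have s4 : G2 * (sqpos (l - a) - sqpos (l - b))
      <= marginal g S P * (sqpos (l - a) - sqpos (l - b)).
    by apply: ler_wpM2r; rewrite ?subr_ge0.
  lra.
- move=> x y mu hx hy mu0 hmu.
  have lmu : l <= mu by rewrite -(ler_pM2r gS) -fS hmu.
  have disj : [disjoint P & S].
    by rewrite disjoint_sym disjoints_subset.
  (* The induction hypothesis is used with [mu] equal to l: S' ∪ S has density at most l over P and
     S has exactly l, so what S' adds to P ∪ S has density at most l. *)
  have domPS S' : S' \subset ~: (P :|: S) ->
      marginal f S' (P :|: S) <= l * marginal g S' (P :|: S).
    move=> S'PS; have : S' :|: S \subset ~: P.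
      by rewrite subUset SP andbT (subset_trans S'PS)// setCS subsetUl.
    move=> /dom; move: fS; rewrite /marginal.
    by rewrite -!setUA !(setUC S P); lra.
  have := PhiLow x y l hx hy l0 domPS.
  have [_ _ /(_ P) xP] := hx; have [_ _ /(_ P) yP] := hy.
  have vU (z : V -> R) : vsum z (P :|: S) = vsum z P + vsum z S.
    by rewrite /vsum -bigU//; apply: eq_bigl => u; rewrite inE.
  have -> : \sum_(u in ~: P) (2 * rho u * x u - rho u ^+ 2 * y u)
      = 2 * l * vsum x S - l ^+ 2 * vsum y S
      + \sum_(u in ~: (P :|: S)) (2 * rho u * x u - rho u ^+ 2 * y u).
    rewrite (big_setID S) /= (setIidPr SP) setDE -setCU; congr (_ + _).
    rewrite /vsum !mulr_sumr -sumrB; apply: eq_bigr => u uS.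
    by rewrite rhoS.
  rewrite !vU subr0 /sqpos (max_idPr l0).
  move: fS; rewrite /marginal (setUC S P) => fS.
  (* Since x(P) >= f(P) and y(P) <= g(P), raising l to [mu] can only increase the boundary terms. *)
  have e1 : l * (vsum x P - f P) <= mu * (vsum x P - f P).
    by rewrite ler_wpM2r ?subr_ge0.
  have e2 : l ^+ 2 * (g P - vsum y P) <= mu ^+ 2 * (g P - vsum y P).
    by rewrite ler_wpM2r ?subr_ge0 ?lerXn2r.
  have e3 : l * (f (P :|: S) - f P) = l ^+ 2 * (g (P :|: S) - g P).
    by rewrite fS mulrA.
  lra.
Qed.

(** In the density of the block containing u, the numerator is at least the marginal of u alone and
    the denominator is at most g(V) = 1. *)
Lemma marginal_min_le_density f g rho P u : dual_modular f g ->
  g setT = 1 -> peeling f g rho P -> u \notin P -> marginal_min f <= rho u.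
Proof.
move=> fg gT; elim=> [|{}P S]; first by rewrite inE.
move=> /maxsetp dS rhoS _ IH uP.
have [uS|uS] := boolP (u \in S); last by apply: IH; rewrite inE negb_or uP.
have [_ gS _ _] := densest_spec fg dS.
rewrite rhoS// /density ler_pdivlMr//.
have m0 : 0 <= marginal f S P by rewrite subr_ge0 (dm_f_mono fg)// subsetUr.
have g1 : marginal g S P <= 1.
  by rewrite lerBlDr -gT ler_wpDr ?(dm_g_ge0 fg) ?(dm_g_mono fg).
have : marginal_min f <= marginal f S P.
  apply: (le_trans (marginal_min_le (dm_f_mono fg) uP)).
  by rewrite lerD2r (dm_f_mono fg)// setSU// sub1set.
have [m1|m1] := lerP 0 (marginal_min f); last by nra.
by move=> h; apply: le_trans h; rewrite ler_piMr.
Qed.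

Lemma greedy_potential f g (Phi : R -> R) (r : V -> R) (s : seq V) :
  f set0 = 0 -> g set0 = 0 -> (forall t, 0 <= Phi t) ->
  (forall A a b, 0 <= a -> a <= b ->
    2 * (b - a) * f A - (b ^+ 2 - a ^+ 2) * g A <= Phi a - Phi b) ->
  (forall u, 0 <= r u) -> is_ordering s ->
  sorted (fun v w => r w <= r v) s ->
  \sum_u (2 * r u * greedy f s u - r u ^+ 2 * greedy g s u) <= Phi 0.
Proof.
move=> f0 g0 Phi0 PhiUp r0 hs srt; rewrite (big_ordering _ _ hs).
(* Here b is the level reached before [s2]. Passing from b down to r u costs one use of [PhiUp] on
   the prefix [s1]; the terms in b are the boundary terms of Abel summation. *)
have key s2 s1 b : s = s1 ++ s2 -> sorted (fun v w => r w <= r v) s2 ->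
    0 <= b -> (forall u, u \in s2 -> r u <= b) ->
    \sum_(u <- s2) (2 * r u * greedy f s u - r u ^+ 2 * greedy g s u)
      + 2 * b * f [set:: s1] - b ^+ 2 * g [set:: s1] <= Phi 0 - Phi b.
  elim: s2 s1 b => [|u s2 IH] s1 b es; move=> srt2 b0 ub.
    by rewrite big_nil; have := PhiUp [set:: s1] 0 b (lexx _) b0; lra.
  have gu h : greedy h s u = h (u |: [set:: s1]) - h [set:: s1].
    by rewrite es greedy_cat// -es ordering_uniq.
  have rub : r u <= b by rewrite ub ?mem_head.
  have tr : transitive (fun v w => r w <= r v).
    by move=> a c d h1 h2; exact: le_trans h1.
  have := IH (rcons s1 u) (r u); rewrite cat_rcons set_cons_rcons.
  have /allP rmin := order_path_min tr srt2.
  move=> /(_ es (path_sorted srt2) (r0 u) rmin).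
  rewrite big_cons !gu; have := PhiUp [set:: s1] (r u) b (r0 u) rub; lra.
(* The sum of r serves as a starting level above every ratio. On the empty prefix the boundary terms
   vanish, and the value of [Phi] there is dropped by nonnegativity. *)
have rsum u : r u <= \sum_v r v by rewrite (bigD1 u)//= lerDl sumr_ge0.
have s0 : 0 <= \sum_v r v by rewrite sumr_ge0.
have := key s [::] _ erefl srt s0 (fun u _ => rsum u).
have -> : [set:: [::]] = set0 :> {set V} by apply/setP => w; rewrite !inE.
by have := Phi0 (\sum_v r v); rewrite f0 g0; lra.
Qed.

End DensityVector.

(** * Convergence rate of the Frank-Wolfe iterates *)

Section FrankWolfe.
Local Set Implicit Arguments.
Local Unset Strict Implicit.
Variables (R : realType) (V : finType).
Implicit Types (f g : {set V} -> R) (x y z t r rho : V -> R).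

Lemma fw_gamma_ge0 k : 0 <= fw_gamma R k.
Proof. by rewrite divr_ge0. Qed.

Lemma fw_gamma_le1 k : fw_gamma R k <= 1.
Proof. by rewrite ler_pdivrMr// mul1r ler_nat. Qed.

Lemma fw_iter_base f g (s : nat -> seq V) T k : dual_modular f g ->
  (forall j, (j <= T)%N -> is_ordering (s j)) -> (k <= T)%N ->
  [/\ base_ge f (fw_iter f s k), base_le g (fw_iter g s k)
    & forall u, marginal_min g <= fw_iter g s k u].
Proof.
move=> fg hs; elim: k => [|k IH] kT /=.
  have h0 := hs _ kT.
  split; [exact: greedy_base_ge fg h0 | exact: greedy_base_le fg h0 | move=> u].
  exact: marginal_min_le_greedy u (dm_g_mono fg) h0.
have [bf bg mg] := IH (ltnW kT).
have g0 := fw_gamma_ge0 k; have g1 := fw_gamma_le1 k.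
have g01 : 0 <= fw_gamma R k <= 1 by rewrite g0.
split.
- exact: base_ge_conv g01 bf (greedy_base_ge fg (hs _ kT)).
- exact: base_le_conv g01 bg (greedy_base_le fg (hs _ kT)).
move=> u; have := mg u.
have := marginal_min_le_greedy u (dm_g_mono fg) (hs _ kT).
move: (fw_gamma R k) (greedy _ _ _) (fw_iter _ _ _ _) (marginal_min g) g0 g1.
move=> a p q m a0 a1 mp mq.
have a1' : 0 <= 1 - a by lra.
have := ler_wpM2l a0 mp; have := ler_wpM2l a1' mq; lra.
Qed.

Lemma le_sum1 z u : (forall v, 0 <= z v) -> \sum_v z v = 1 -> z u <= 1.
Proof. by move=> z0 <-; rewrite (bigD1 u)//= lerDl sumr_ge0. Qed.

(** Completing the square at r = x / y leaves the error a^2 (z - r t)^2 / w, where w is the new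
    denominator. As r <= 1/m and z, t <= 1, the square is at most z + t / m^2. This bound is linear
    in z and t, so that summing it over V brings in no factor |V|. *)
Lemma quad_convex_step (m a x y z t : R) : 0 < m -> 0 <= a <= 1 ->
  m <= y -> m <= t -> 0 <= x -> x <= 1 -> 0 <= z -> z <= 1 -> t <= 1 ->
  ((1 - a) * x + a * z) ^+ 2 / ((1 - a) * y + a * t)
    <= (1 - a) * (x ^+ 2 / y)
       + a * (2 * (x / y) * z - (x / y) ^+ 2 * t)
       + a ^+ 2 * ((z + t / m ^+ 2) / m).
Proof.
move=> m0 /andP[a0 a1] my mt x0 x1 z0 z1 t1.
have y0 : 0 < y by exact: lt_le_trans my.
have t0 : 0 < t by exact: lt_le_trans mt.
set w := (1 - a) * y + a * t.
have mw : m <= w by rewrite /w; nra.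
have w0 : 0 < w by exact: lt_le_trans mw.
have -> : ((1 - a) * x + a * z) ^+ 2 / w
    = (1 - a) * (x ^+ 2 / y) + a * (2 * (x / y) * z - (x / y) ^+ 2 * t)
      + a ^+ 2 * ((z - x / y * t) ^+ 2 / w).
  by rewrite /w; field; rewrite -/w !gt_eqF.
rewrite lerD2l ler_wpM2l ?sqr_ge0//.
set r := x / y.
have r0 : 0 <= r by rewrite divr_ge0// ltW.
have rm : r <= m^-1.
  rewrite /r ler_pdivrMr//; apply: (le_trans x1).
  by rewrite mulrC ler_pdivlMr// mul1r.
have r2 : r ^+ 2 <= m ^- 2.
  by rewrite -exprVn lerXn2r ?nnegrE ?invr_ge0 ?(ltW m0).
have num : (z - r * t) ^+ 2 <= z + t / m ^+ 2.
  have h1 : r ^+ 2 * t <= t / m ^+ 2 by rewrite mulrC ler_wpM2l// ltW.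
  have h2 : 0 <= r * t * z by rewrite mulr_ge0// mulr_ge0// ltW.
  have h3 : r ^+ 2 * (t * t) <= r ^+ 2 * t.
    by rewrite ler_wpM2l ?sqr_ge0// ler_piMr// ltW.
  have h4 : z * z <= z by rewrite ler_piMr.
  nra.
apply: (@le_trans _ _ ((z + t / m ^+ 2) / w)).
  by rewrite ler_wpM2r// invr_ge0 ltW.
rewrite ler_wpM2l// ?lef_pV2 ?posrE//.
by rewrite addr_ge0// divr_ge0 ?sqr_ge0// ltW.
Qed.

Definition obj x y : R := \sum_u x u ^+ 2 / y u.

Lemma obj_step (m a : R) x y z t : 0 < m -> m <= 1 -> 0 <= a <= 1 ->
  (forall u, 0 <= x u) -> (forall u, 0 <= z u) ->
  (forall u, m <= y u) -> (forall u, m <= t u) ->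
  \sum_u x u = 1 -> \sum_u z u = 1 -> \sum_u t u = 1 ->
  obj (fun u => (1 - a) * x u + a * z u) (fun u => (1 - a) * y u + a * t u)
    <= (1 - a) * obj x y
       + a * (\sum_u (2 * (x u / y u) * z u - (x u / y u) ^+ 2 * t u))
       + a ^+ 2 * (2 / m ^+ 3).
Proof.
move=> m0 m1 a01 x0 z0 my mt xT zT tT.
have t0 u : 0 <= t u by rewrite (le_trans (ltW m0)).
apply: (@le_trans _ _ (\sum_u ((1 - a) * (x u ^+ 2 / y u)
       + a * (2 * (x u / y u) * z u - (x u / y u) ^+ 2 * t u)
       + a ^+ 2 * ((z u + t u / m ^+ 2) / m)))).
  apply: ler_sum => u _; apply: quad_convex_step => //.
  - exact: le_sum1 x0 xT.
  - exact: le_sum1 z0 zT.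
  - exact: le_sum1 t0 tT.
rewrite /obj 2!big_split /= -!mulr_sumr lerD2l ler_wpM2l ?sqr_ge0//.
rewrite -mulr_suml big_split /= -mulr_suml zT tT.
have im1 : 1 <= m^-1 by rewrite -invr1 lef_pV2 ?posrE.
have -> : (1 + 1 / m ^+ 2) / m = m^-1 + m^-1 ^+ 3 by field; rewrite gt_eqF.
have -> : 2 / m ^+ 3 = m^-1 ^+ 3 + m^-1 ^+ 3 by field; rewrite gt_eqF.
by rewrite lerD2r -[leLHS]expr1 ler_weXn2l.
Qed.

(** With n = k + 2, the new bound times n + 1 is 4 K (1 - 1/n^2), hence at most 4 K. *)
Lemma fw_rate_step (k : nat) (h K : R) : 0 <= K -> h <= 4 * K / k.+2%:R ->
  (1 - fw_gamma R k) * h + fw_gamma R k ^+ 2 * K <= 4 * K / k.+3%:R.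
Proof.
move=> K0 hk.
have g1 : 0 <= 1 - fw_gamma R k by rewrite subr_ge0 fw_gamma_le1.
have h1 := ler_wpM2l g1 hk.
apply: (le_trans (lerD h1 (lexx _))); rewrite /fw_gamma.
have -> : k.+3%:R = k.+2%:R + 1 :> R by rewrite -natr1.
have : 2 <= k.+2%:R :> R by rewrite ler_nat.
move: (k.+2%:R) => n n2.
rewrite ler_pdivlMr; last by lra.
have -> : ((1 - 2 / n) * (4 * K / n) + (2 / n) ^+ 2 * K) * (n + 1)
   = 4 * K * (1 - (n ^+ 2)^-1) by field; rewrite gt_eqF//; lra.
by rewrite ler_piMr ?mulr_ge0// lerBlDr lerDl invr_ge0 sqr_ge0.
Qed.

Lemma fw_gap f g rho (s : nat -> seq V) T : dual_modular f g ->
  f setT = 1 -> g setT = 1 -> density_vector f g rho -> fw_run f g T s ->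
  0 < marginal_min g -> marginal_min g <= 1 ->
  obj (fw_iter f s T) (fw_iter g s T)
    - \sum_u (2 * rho u * fw_iter f s T u - rho u ^+ 2 * fw_iter g s T u)
  <= 8 / (marginal_min g ^+ 3 * (T + 2)%:R).
Proof.
move=> fg fT gT dv [hs srt] m0 m1.
set m := marginal_min g in m0 m1 *.
have [Phi [Phi0 PhiUp PhiLow]] := peeling_potential fg dv.
have f0 := dm_f0 fg; have g0 := dm_g0 fg.
have base k (kT : (k <= T)%N) := fw_iter_base fg hs kT.
have sumT (z : V -> R) : \sum_u z u = vsum z setT.
  by rewrite /vsum; apply: eq_bigl => u; rewrite inE.
have rate k : (k <= T)%N ->
    obj (fw_iter f s k) (fw_iter g s k) - Phi 0 <= 4 * (2 / m ^+ 3) / k.+2%:R.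
  elim: k => [|k IH] kT.
    have [[x0 xT _] _ my] := base _ kT.
    (* Initially D <= 1/m, because x <= 1 sums to 1 and y >= m; then 1/m <= 4/m^3. *)
    apply: (@le_trans _ _ (m^-1)).
      rewrite lerBlDr ler_wpDr// /obj.
      rewrite -[leRHS]mul1r -fT -xT -sumT mulr_suml; apply: ler_sum => u _.
      have x1 : fw_iter f s 0 u <= 1 by rewrite le_sum1// sumT xT.
      have y0 := lt_le_trans m0 (my u).
      apply: ler_pM; rewrite ?sqr_ge0 ?invr_ge0 ?(ltW y0)//.
        by rewrite expr2 ler_piMr.
      by rewrite lef_pV2 ?posrE.
    have im1 : 1 <= m^-1 by rewrite -invr1 lef_pV2 ?posrE.
    have -> : 4 * (2 / m ^+ 3) / 2 = 4 * m^-1 ^+ 3 by field; rewrite gt_eqF.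
    have := ler_weXn2l im1 (_ : 1 <= 3)%N; rewrite expr1 => /(_ isT).
    lra.
  have [[x0 xT _] [y0 yT _] my] := base _ (ltnW kT).
  have [z0 zT _] := greedy_base_ge fg (hs _ kT).
  have [_ tT _] := greedy_base_le fg (hs _ kT).
  have mt u := marginal_min_le_greedy u (dm_g_mono fg) (hs _ kT).
  have lin : \sum_u (2 * fw_ratio f g s k u * greedy f (s k.+1) u
      - fw_ratio f g s k u ^+ 2 * greedy g (s k.+1) u) <= Phi 0.
    apply: (greedy_potential f0 g0 Phi0) => //; last 2 first.
    - exact: hs.
    - exact: srt.
    - move=> A a b a0 ab; have := PhiUp A a b a0 ab.
      by rewrite /marginal setU0 f0 g0 !subr0.
    - by move=> u; rewrite divr_ge0.
  have g01 : 0 <= fw_gamma R k <= 1 by rewrite fw_gamma_ge0 fw_gamma_le1.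
  have step := obj_step m0 m1 g01 x0 z0 my mt (etrans (sumT _) (etrans xT fT))
    (etrans (sumT _) (etrans zT fT)) (etrans (sumT _) (etrans tT gT)).
  have K0 : 0 <= 2 / m ^+ 3 by rewrite divr_ge0// exprn_ge0// ltW.
  apply: le_trans (fw_rate_step K0 (IH (ltnW kT))).
  have := ler_wpM2l (fw_gamma_ge0 k) lin.
  rewrite /obj /fw_ratio /= in step *; lra.
have := rate T (leqnn T); rewrite addn2.
have n0 : T.+2%:R != 0 :> R by rewrite pnatr_eq0.
move: (T.+2%:R) n0 => n n0.
have -> : 4 * (2 / m ^+ 3) / n = 8 / (m ^+ 3 * n) by field; rewrite n0 gt_eqF.
have [hx hy _] := base _ (leqnn T).
(* The slope 1/m dominates all densities, since f <= 1 and g >= m on nonempty sets. Its boundary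
   terms vanish at the empty set. *)
have dom (S : {set V}) : S \subset ~: set0 ->
    marginal f S set0 <= m^-1 * marginal g S set0.
  move=> _; rewrite /marginal setU0 f0 g0 !subr0.
  have [->|/set0Pn[u uS]] := eqVneq S set0; first by rewrite f0 g0 mulr0.
  rewrite mulrC ler_pdivlMr//; have fS : f S <= 1 by rewrite -fT (dm_f_mono fg).
  have : m <= g S.
    have := marginal_min_le (dm_g_mono fg) (_ : u \notin set0).
    rewrite inE setU0 g0 subr0 => /(_ isT)/le_trans; apply.
    by rewrite (dm_g_mono fg)// sub1set.
  apply: le_trans; rewrite ler_piMl// ltW//.
have im0 : 0 <= m^-1 by rewrite invr_ge0 ltW.
have := PhiLow _ _ _ hx hy im0 dom.
rewrite /vsum !big_set0 f0 g0 !subr0 !mulr0 !addr0.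
under [in X in _ <= X]eq_bigl do rewrite !inE.
lra.
Qed.

End FrankWolfe.

(** * From the objective gap to the distance from the density vector *)

Theorem theorem1p8 (R : realType) :
  exists C : R, 0 < C /\
  forall (V : finType) (f g : {set V} -> R) (rho : V -> R)
    (T : nat) (s : nat -> seq V),
    dual_modular f g ->
    f [set: V] = 1 ->
    g [set: V] = 1 ->
    density_vector f g rho ->
    fw_run f g T s ->
    [/\ base_ge f (fw_iter f s T),
        base_le g (fw_iter g s T),
        norm2 (fun u => fw_ratio f g s T u - rho u)
          <= C / (marginal_min g `^ (5 / 2) * Num.sqrt (T + 2)%:R)
      & 0 < marginal_min f ->
        forall u : V,
          `| (fw_ratio f g s T u - rho u) / rho u |
            <= C / (marginal_min f * marginal_min g `^ (5 / 2)
                    * Num.sqrt (T + 2)%:R)].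
Proof.
(* The constant comes from sqrt 8 <= 3. *)
exists 3; split=> // V f g rho T s fg fT gT dv run.
have [u0 _] : exists u : V, u \in [set: V].
  apply/set0Pn; apply: contraTneq (oner_neq0 R) => VT.
  by rewrite -fT VT (dm_f0 fg) eqxx.
have m0 := marginal_min_gt0 u0 (dm_g_smono fg).
have m1 : marginal_min g <= 1.
  apply: (le_trans (marginal_min_le (dm_g_mono fg) (_ : u0 \notin set0))).
    by rewrite inE.
  by rewrite (dm_g0 fg) subr0 -gT (dm_g_mono fg).
have gap := fw_gap fg fT gT dv run m0 m1.
have [hx hy my] := fw_iter_base fg run.1 (leqnn T).
set m := marginal_min g in m0 m1 gap my *.
have n0 : 0 < (T + 2)%:R :> R by rewrite ltr0n addn2.
have sq : \sum_u (fw_ratio f g s T u - rho u) ^+ 2 <= 8 / (m ^+ 4 * (T + 2)%:R).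
  have -> : 8 / (m ^+ 4 * (T + 2)%:R) = 8 / (m ^+ 3 * (T + 2)%:R) / m.
    by move: (_%:R) n0 => n n0; field; rewrite !gt_eqF.
  rewrite ler_pdivlMr//; apply: le_trans gap.
  rewrite /obj -sumrB mulr_suml; apply: ler_sum => u _; rewrite /fw_ratio.
  have y0 := lt_le_trans m0 (my u).
  have -> : fw_iter f s T u ^+ 2 / fw_iter g s T u
      - (2 * rho u * fw_iter f s T u - rho u ^+ 2 * fw_iter g s T u)
      = (fw_iter f s T u / fw_iter g s T u - rho u) ^+ 2 * fw_iter g s T u.
    by field; rewrite gt_eqF.
  by rewrite ler_wpM2l ?sqr_ge0.
have pm0 : 0 < m `^ (5 / 2) by rewrite powR_gt0.
have sT0 : 0 < Num.sqrt (T + 2)%:R :> R by rewrite sqrtr_gt0.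
have norm_le : norm2 (fun u => fw_ratio f g s T u - rho u)
    <= 3 / (m `^ (5 / 2) * Num.sqrt (T + 2)%:R).
  (* The square root of m^4 gives the exponent 2, which is relaxed to 5/2 using m <= 1. *)
  apply: (@le_trans _ _ (3 / (m ^+ 2 * Num.sqrt (T + 2)%:R))).
    have c0 : 0 <= 3 / (m ^+ 2 * Num.sqrt (T + 2)%:R).
      by rewrite divr_ge0// mulr_ge0 ?sqr_ge0// ltW.
    rewrite /norm2 -(ger0_norm c0) -sqrtr_sqr ler_wsqrtr//.
    apply: (le_trans sq); rewrite expr_div_n exprMn sqr_sqrtr ?(ltW n0)//.
    rewrite -exprM ler_pM2r ?invr_gt0 ?mulr_gt0 ?exprn_gt0//.
    lra.
  rewrite ler_pM2l// lef_pV2 ?posrE ?mulr_gt0 ?exprn_gt0//.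
  rewrite ler_pM2r// -powR_mulrn ?(ltW m0)//.
  apply: ger_powR; first by rewrite m0.
  by rewrite ler_pdivlMr// -natrM ler_nat.
split=> // mf0 u.
have rho_ge : marginal_min f <= rho u.
  by apply: (marginal_min_le_density fg gT dv); rewrite inE.
have rho0 := lt_le_trans mf0 rho_ge.
have abs_le : `|fw_ratio f g s T u - rho u|
    <= norm2 (fun u => fw_ratio f g s T u - rho u).
  rewrite -sqrtr_sqr ler_wsqrtr// (bigD1 u)//= lerDl.
  by rewrite sumr_ge0// => v _; rewrite sqr_ge0.
rewrite normrM normfV (gtr0_norm rho0).
have -> : 3 / (marginal_min f * m `^ (5 / 2) * Num.sqrt (T + 2)%:R)
   = 3 / (m `^ (5 / 2) * Num.sqrt (T + 2)%:R) / marginal_min f.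
  by field; rewrite !gt_eqF.
apply: ler_pM => //; first by rewrite invr_ge0 ltW.
  exact: le_trans norm_le.
by rewrite lef_pV2.
Qed.
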